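(* Let $\mathbf{w}^*$ and $\mathbf{u}^*$ be fixed parameter vectors, let $d_n\ge 1$ and let $\{(\mathbf{x}_n^t,\mathbf{y}_n^t)\}_{t=1}^{d_n}$ be fixed data. Let $\varphi(\mathbf{u};\mathbf{x})$ (a network with parameter $\mathbf{u}$, output in the same Euclidean space as $\mathbf{v}$) and $\phi(\mathbf{w},\mathbf{v};\mathbf{x})$ be given maps, and $\ell(\cdot,\cdot)\ge 0$ a loss function. Define $$f^\varphi_n(\mathbf{u},\mathbf{v}):=\sum_{t=1}^{d_n}\|\varphi(\mathbf{u};\mathbf{x}_n^t)-\mathbf{v}\|^2,\qquad f^\phi_n(\mathbf{w},\mathbf{v}):=\sum_{t=1}^{d_n}\ell\big(\phi(\mathbf{w},\mathbf{v};\mathbf{x}_n^t),\mathbf{y}_n^t\big),$$ and, for constants $c_1,c_2,c_3,c_4>0$, $$g(\mathbf{u},\mathbf{v}):=c_1 f^\varphi_n(\mathbf{u},\mathbf{v})+c_3\|\mathbf{u}\|^2,\qquad F(\mathbf{u},\mathbf{v}):=g(\mathbf{u},\mathbf{v})+f^\phi_n(\mathbf{w}^*,\mathbf{v})+c_2\|\mathbf{u}-\mathbf{u}^*\|^2+c_4\|\mathbf{v}\|^2 .$$ Suppose $f^\varphi_n$ and $f^\phi_n$ (the latter as a function of $\mathbf{v}$ with $\mathbf{w}=\mathbf{w}^*$) are twice continuously differentiable. Consider the iteration: $\mathbf{u}_n^0=\mathbf{u}^*$, $\mathbf{v}_n^0=\frac{1}{d_n}\sum_{t=1}^{d_n}\varphi(\mathbf{u}^*;\mathbf{x}_n^t)$,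 and for $\ell=0,1,2,\dots$, with $\boldsymbol\zeta_n^\ell:=\nabla_{\mathbf{u}}g(\mathbf{u}_n^\ell,\mathbf{v}_n^\ell)$ and $\boldsymbol\xi_n^\ell:=\nabla_{\mathbf{v}}f^\phi_n(\mathbf{w}^*,\mathbf{v}_n^\ell)$, $$\mathbf{u}_n^{\ell+1}=\arg\min_{\mathbf{u}}\ \langle\boldsymbol\zeta_n^\ell,\mathbf{u}\rangle+\tau^\ell\|\mathbf{u}-\mathbf{u}_n^\ell\|^2+c_2\|\mathbf{u}-\mathbf{u}^*\|^2=\tfrac{1}{\tau^\ell+c_2}\big(\tau^\ell\mathbf{u}_n^\ell+c_2\mathbf{u}^*-\tfrac12\boldsymbol\zeta_n^\ell\big),$$ $$\mathbf{v}_n^{\ell+1}=\arg\min_{\mathbf{v}}\ c_1f^\varphi_n(\mathbf{u}_n^{\ell+1},\mathbf{v})+\langle\boldsymbol\xi_n^\ell,\mathbf{v}\rangle+\kappa^\ell\|\mathbf{v}-\mathbf{v}_n^\ell\|^2+c_4\|\mathbf{v}\|^2=\tfrac{1}{c_1d_n+c_4+\kappa^\ell}\Big(c_1\sum_{t=1}^{d_n}\varphi(\mathbf{u}_n^{\ell+1};\mathbf{x}_n^t)+\kappa^\ell\mathbf{v}_n^\ell-\tfrac12\boldsymbol\xi_n^\ell\Big),$$ where $\tau^\ell,\kappa^\ell>0$. Let $F^0:=F(\mathbf{u}_n^0,\mathbf{v}_n^0)$, $\Omega:=\{(\mathbf{u},\mathbf{v}):F(\mathbf{u},\mathbf{v})\le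 F^0\}$, $\mathbb{B}(\mathbf{a},\delta):=\{\mathbf{u}:\|\mathbf{u}-\mathbf{a}\|^2\le\delta\}$, $$\delta_{\mathbf{u}}^*:=\tfrac{3}{c_2}F^0+\tfrac{2}{c_2^2}\sup_{(\mathbf{u},\mathbf{v})\in\Omega}\|\nabla_{\mathbf{u}}g(\mathbf{u},\mathbf{v})\|^2,\qquad \delta_{\mathbf{v}}^*:=\tfrac{3}{c_4}F^0+\tfrac{2}{c_4^2}\sup_{(\mathbf{u},\mathbf{v})\in\Omega}\|\nabla_{\mathbf{v}}f^\phi_n(\mathbf{w}^*,\mathbf{v})\|^2,$$ $$\tau^*:=\sup_{(\mathbf{u},\mathbf{v})\in\mathbb{B}(\mathbf{u}^*,\delta_{\mathbf{u}}^* )\times\mathbb{B}(0,F^0/c_4)}\tfrac12\|\nabla^2_{\mathbf{u}\mathbf{u}}g(\mathbf{u},\mathbf{v})\|,\qquad \kappa^*:=\sup_{\mathbf{v}\in\mathbb{B}(0,\delta_{\mathbf{v}}^* )}\tfrac12\|\nabla^2_{\mathbf{v}\mathbf{v}}f^\phi_n(\mathbf{w}^*,\mathbf{v})\|,$$ where $\|\cdot\|$ is the Euclidean norm for vectors and the spectral norm for matrices. If $\tau^\ell>\tau^*$ and $\kappa^\ell>\kappa^*$ for all $\ell\ge0$, then the sequence $\{F(\mathbf{u}_n^\ell,\mathbf{v}_n^\ell)\}$ is strictly decreasing and converges, and $\lim_{\ell\to\infty}(\mathbf{u}_n^{\ell+1}-\mathbf{u}_n^\ell)=0$ and $\lim_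{\ell\to\infty}(\mathbf{v}_n^{\ell+1}-\mathbf{v}_n^\ell)=0$.
   Context: This is the convergence result for an inexact alternating direction method (iADM) applied to the problem $\min_{\mathbf{u},\mathbf{v}}F(\mathbf{u},\mathbf{v})$, used to adapt a model to a new environment from $d_n$ few-shot samples; $\mathbf{w}^*$ and $\mathbf{u}^*$ are previously learned parameters. $\nabla^2_{\mathbf{u}\mathbf{u}}g(\mathbf{u},\mathbf{v})$ denotes the Hessian of $g(\cdot,\mathbf{v})$ and $\nabla^2_{\mathbf{v}\mathbf{v}}f^\phi_n(\mathbf{w}^*,\mathbf{v})$ the Hessian of $f^\phi_n(\mathbf{w}^*,\cdot)$.
   Formalization: ''Strictly decreasing'' is stated as: F never increases, and it strictly decreases at every step where (u,v) actually changes; the literal claim fails when the iteration starts at a fixed point (e.g. φ-network = 0, loss = 0, u* = 0, where F is constantly 0). *)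

(* Defs.v *)
From HB Require Import structures.
From mathcomp Require Import all_boot all_order all_algebra.
From mathcomp Require Import all_classical all_reals all_analysis.
Set Implicit Arguments. Unset Strict Implicit. Unset Printing Implicit Defensive.
Import Order.TTheory GRing.Theory Num.Theory.
Import numFieldNormedType.Exports.
Local Open Scope classical_set_scope.
Local Open Scope ring_scope.

Section Defs.
Variable R : realType.

Definition enorm {n} (v : 'rV[R]_n) : R := Num.sqrt (\sum_i (v 0 i) ^+ 2).
Definition edot {n} (u v : 'rV[R]_n) : R := \sum_i u 0 i * v 0 i.

Definition ebasis {n} (i : 'I_n) : 'rV[R]_n := delta_mx 0 i.

Definition grad {n} (f : 'rV[R]_n -> R) (x : 'rV[R]_n) : 'rV[R]_n :=
  \row_i 'D_(ebasis i) f x.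

Definition hessian {n} (f : 'rV[R]_n -> R) (x : 'rV[R]_n) : 'M[R]_n :=
  \matrix_(i, j) 'D_(ebasis j) ('D_(ebasis i) f) x.

Definition specnorm {n} (A : 'M[R]_n) : R :=
  sup [set enorm (x *m A) | x in [set x : 'rV[R]_n | enorm x <= 1]].

(* twice continuously differentiable on R^n: all first and second partial
   derivatives exist everywhere and the second partials are continuous
   (equivalent to the usual C^2 notion on R^n). *)
Definition C2 {n} (f : 'rV[R]_n -> R) : Prop :=
  (forall x i, derivable f x (ebasis i)) /\
  (forall x i j, derivable ('D_(ebasis i) f) x (ebasis j)) /\
  (forall i j, continuous ('D_(ebasis j) ('D_(ebasis i) f))).

Definition eball {n} (a : 'rV[R]_n) (delta : \bar R) : set 'rV[R]_n :=
  [set x | ((enorm (x - a)) ^+ 2)%:E <= delta]%E.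

Definition fvarphi {p m d : nat} {X : Type} (varphi : 'rV[R]_p -> X -> 'rV[R]_m)
  (xs : 'I_d -> X) (u : 'rV[R]_p) (v : 'rV[R]_m) : R :=
  \sum_(t < d) (enorm (varphi u (xs t) - v)) ^+ 2.

Definition fphi {m d : nat} {W X Y O : Type} (phi : W -> 'rV[R]_m -> X -> O)
  (loss : O -> Y -> R) (xs : 'I_d -> X) (ys : 'I_d -> Y) (w : W) (v : 'rV[R]_m) : R :=
  \sum_(t < d) loss (phi w v (xs t)) (ys t).

End Defs.

(* Main.v *)
Require Import Defs.
From HB Require Import structures.
From mathcomp Require Import all_boot all_order all_algebra.
From mathcomp Require Import all_classical all_reals all_analysis.
From mathcomp Require Import ring lra.
Set Implicit Arguments. Unset Strict Implicit. Unset Printing Implicit Defensive.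
Import Order.TTheory GRing.Theory Num.Theory.
Import numFieldNormedType.Exports.
Local Open Scope classical_set_scope.
Local Open Scope ring_scope.

(* Each block update minimises a linearisation plus a quadratic, so completing the
   square turns its optimality condition into an exact identity.  Adding the descent
   inequality f(y) <= f(x) + <grad f(x), y - x> + K |y - x|^2, valid as soon as half
   the Hessian norm is at most K on the segment [x, y], yields
     F(u+, v)  <= F(u, v)  - (tau + c2) |u+ - u|^2,
     F(u+, v+) <= F(u+, v) - (kappa + c1 d + c4) |v+ - v|^2.
   The radii delta_u and delta_v are what is needed for both ends of the segment,
   hence the whole segment, to stay in the balls over which tau_star and kappa_star
   are taken; this uses (u, v) in Omega, which is preserved by the decrease. *)

Section Euclidean.
Variables (R : realType) (n : nat).
Implicit Types (x y z : 'rV[R]_n) (a : R).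

Lemma edotC x y : edot x y = edot y x.
Proof. by apply: eq_bigr => i _; rewrite mulrC. Qed.

Lemma edotDl x y z : edot (x + y) z = edot x z + edot y z.
Proof. by rewrite -big_split; apply: eq_bigr => i _; rewrite mxE mulrDl. Qed.

Lemma edotZl a x y : edot (a *: x) y = a * edot x y.
Proof. by rewrite mulr_sumr; apply: eq_bigr => i _; rewrite mxE mulrA. Qed.

Lemma edotNl x y : edot (- x) y = - edot x y.
Proof. by rewrite -scaleN1r edotZl mulN1r. Qed.

Lemma edot0l y : edot 0 y = 0.
Proof. by rewrite -(scale0r y) edotZl mul0r. Qed.

Lemma edotDr x y z : edot x (y + z) = edot x y + edot x z.
Proof. by rewrite edotC edotDl !(edotC x). Qed.

Lemma edotZr a x y : edot x (a *: y) = a * edot x y.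
Proof. by rewrite edotC edotZl edotC. Qed.

Lemma edotNr x y : edot x (- y) = - edot x y.
Proof. by rewrite edotC edotNl edotC. Qed.

Lemma edot_suml (I : Type) (r : seq I) (f : I -> 'rV[R]_n) y :
  edot (\sum_(i <- r) f i) y = \sum_(i <- r) edot (f i) y.
Proof.
elim/big_rec2: _ => [|i a x _ <-]; first exact: edot0l.
by rewrite edotDl.
Qed.

Lemma enorm_ge0 x : 0 <= enorm x.
Proof. exact: sqrtr_ge0. Qed.

Lemma enorm_sqr x : enorm x ^+ 2 = edot x x.
Proof.
rewrite sqr_sqrtr; first by apply: eq_bigr => i _; rewrite expr2.
by apply: sumr_ge0 => i _; exact: sqr_ge0.
Qed.

Lemma edot_ge0 x : 0 <= edot x x.
Proof. by rewrite -enorm_sqr sqr_ge0. Qed.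

Lemma sqr_coord_le_edot x i : x 0 i ^+ 2 <= edot x x.
Proof.
rewrite /edot (bigD1 i)//= expr2 lerDl.
by apply: sumr_ge0 => j _; rewrite -expr2 sqr_ge0.
Qed.

Lemma edot_eq0 x : edot x x = 0 -> x = 0.
Proof.
move=> x0; apply/rowP => i; rewrite mxE; apply/eqP.
by rewrite -sqrf_eq0 eq_le sqr_ge0 -x0 sqr_coord_le_edot.
Qed.

Lemma enorm_eq0 x : enorm x = 0 -> x = 0.
Proof. by move=> x0; apply: edot_eq0; rewrite -enorm_sqr x0 expr0n. Qed.

Lemma enormZ a x : enorm (a *: x) = `|a| * enorm x.
Proof.
apply/eqP; rewrite -(@eqrXn2 _ 2)// ?mulr_ge0 ?enorm_ge0//.
by rewrite exprMn !enorm_sqr real_normK ?num_real// edotZl edotZr mulrA expr2.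
Qed.

Lemma edot_young e x y : 0 < e ->
  edot x y <= (e * edot x x + e^-1 * edot y y) / 2.
Proof.
move=> e0; have := edot_ge0 (e *: x - y).
rewrite !(edotDl, edotDr, edotNl, edotNr, edotZl, edotZr) (edotC y x) => H.
rewrite -(ler_pM2l e0); have -> : e * ((e * edot x x + e^-1 * edot y y) / 2) =
  (e * (e * edot x x) + edot y y) / 2 by field; rewrite gt_eqF.
lra.
Qed.

Lemma edot_le_enorm x y : edot x y <= enorm x * enorm y.
Proof.
have [x0|x0] := eqVneq (enorm x) 0; first by rewrite x0 mul0r (enorm_eq0 x0) edot0l.
have [y0|y0] := eqVneq (enorm y) 0.
  by rewrite y0 mulr0 edotC (enorm_eq0 y0) edot0l.
have xp : 0 < enorm x by rewrite lt_def x0 enorm_ge0.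
have yp : 0 < enorm y by rewrite lt_def y0 enorm_ge0.
apply: le_trans (edot_young (e := enorm y / enorm x) x y _) _; first exact: divr_gt0.
rewrite -!enorm_sqr le_eqVlt; apply/orP; left; apply/eqP.
by field; rewrite x0 y0.
Qed.

Lemma ler_edot_segment a x y : 0 <= a <= 1 ->
  edot ((1 - a) *: x + a *: y) ((1 - a) *: x + a *: y) <=
  (1 - a) * edot x x + a * edot y y.
Proof.
move=> /andP[a0 a1]; have := edot_ge0 (x - y).
rewrite !(edotDl, edotDr, edotNl, edotNr, edotZl, edotZr) (edotC y x) => H.
have : 0 <= a * (1 - a) * (edot x x - edot x y - (edot x y - edot y y)).
  by rewrite !mulr_ge0//; lra.
lra.
Qed.

End Euclidean.

Section SpectralNorm.
Variables (R : realType) (n : nat).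
Implicit Types (x : 'rV[R]_n) (A : 'M[R]_n).

Lemma enorm_mulmx_bounded A :
  has_ubound [set enorm (x *m A) | x in [set x : 'rV[R]_n | enorm x <= 1]].
Proof.
exists (Num.sqrt (\sum_j (\sum_i `|A i j|) ^+ 2)) => _ [x /= x1 <-].
rewrite ler_wsqrtr// ler_sum// => j _.
rewrite -real_normK ?num_real// lerXn2r ?nnegrE ?sumr_ge0//.
rewrite mxE (le_trans (ler_norm_sum _ _ _))// ler_sum// => i _.
rewrite normrM ler_piMl// -(@expr_le1 _ 2)// real_normK ?num_real//.
by rewrite (le_trans (sqr_coord_le_edot _ _))// -enorm_sqr expr_le1// enorm_ge0.
Qed.

Lemma edot_mulmx_le A x : edot (x *m A) x <= specnorm A * edot x x.
Proof.
have [x0|x0] := eqVneq (enorm x) 0.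
  by rewrite (enorm_eq0 x0) mul0mx !edot0l mulr0.
have xp : 0 < enorm x by rewrite lt_def x0 enorm_ge0.
apply: le_trans (edot_le_enorm _ _) _.
rewrite -enorm_sqr expr2 mulrA ler_wpM2r ?enorm_ge0// -ler_pdivrMr//.
have -> : enorm (x *m A) / enorm x = enorm (((enorm x)^-1 *: x) *m A).
  by rewrite -scalemxAl enormZ ger0_norm ?invr_ge0 ?enorm_ge0// mulrC.
apply: ub_le_sup; first exact: enorm_mulmx_bounded.
exists ((enorm x)^-1 *: x) => //=.
by rewrite enormZ ger0_norm ?invr_ge0 ?enorm_ge0// mulVf.
Qed.

End SpectralNorm.

Section Differentiability.
Variables (R : realType) (n : nat).
Implicit Types (x v h : 'rV[R]_n) (f : 'rV[R]_n -> R).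

Lemma coord_le_norm h i : `|h 0 i| <= `|h|.
Proof.
rewrite [leRHS]/Num.norm /= mx_normrE; apply/bigmax_geP; right => /=.
by exists (0, i).
Qed.

Lemma norm_le_coord h (e : R) : 0 <= e -> (forall i, `|h 0 i| <= e) -> `|h| <= e.
Proof.
move=> e0 he; rewrite [leLHS]/Num.norm /= mx_normrE; apply/bigmax_leP; split=> //.
by move=> [i j] _ /=; rewrite ord1.
Qed.

Lemma is_derive_line f x v (t : R) : derivable f (x + t *: v) v ->
  is_derive t (1 : R) (fun s : R => f (x + s *: v)) ('D_v f (x + t *: v)).
Proof.
rewrite /derivable => df.
have E : (fun h : R => h^-1 *:
           (((fun s : R => f (x + s *: v)) \o shift t) (h *: (1 : R)) -
            f (x + t *: v))) =
         (fun h : R => h^-1 *: ((f \o shift (x + t *: v)) (h *: v) - f (x + t *: v))).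
  apply/funext => h /=; congr (_ *: (f _ - _)).
  by rewrite [h%:A]mulr1 scalerDl addrCA.
by apply: DeriveDef; rewrite /derivable /derive E.
Qed.

Lemma MVT_line f x v (a : R) : (forall y, derivable f y v) ->
  exists2 t : R, `|t| <= `|a| & f (x + a *: v) - f x = a * 'D_v f (x + t *: v).
Proof.
move=> df.
have dl (t : R) := is_derive_line (df (x + t *: v)).
have cl A : {within A, continuous (fun s : R => f (x + s *: v))}.
  apply: continuous_subspaceT => t.
  by apply: differentiable_continuous; apply/derivable1_diffP.
have M b c (bc : b <= c) := @MVT_segment R (fun s => f (x + s *: v))
   (fun t => 'D_v f (x + t *: v)) b c bc (fun t _ => dl t) (cl _).
have [a0|a0] := leP 0 a.
  have [c] := M _ _ a0; rewrite in_itv /= => /andP[c0 ca] E.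
  exists c; first by rewrite !ger0_norm.
  by move: E; rewrite scale0r addr0 subr0 mulrC.
have [c] := M _ _ (ltW a0); rewrite in_itv /= => /andP[ac c0] E.
exists c; first by rewrite ler0_norm// ltr0_norm// lerN2.
move: E; rewrite scale0r addr0 sub0r; lra.
Qed.

(* Walk from x to x + h one coordinate at a time, with the mean value theorem
   on each leg. *)
Lemma continuous_partial_differentiable f :
  (forall x i, derivable f x (ebasis R i)) ->
  (forall i, continuous ('D_(ebasis R i) f)) ->
  forall x, differentiable f x /\ forall h, 'D_h f x = edot (grad f x) h.
Proof.
move=> df cf x.
have Llin : linear (fun h => edot (grad f x) h).
  by move=> a h k; rewrite edotDr edotZr.
pose LM := GRing.isLinear.Build _ _ _ _ _ Llin.
pose L : {linear 'rV[R]_n -> R} := HB.pack (fun h => edot (grad f x) h) LM.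
have Lc : continuous L.
  apply: (@continuous_big R _ +%R 0); first exact: add_continuous.
  move=> i _ h; exact: (cvgM (cvg_cst (grad f x 0 i)) (@coord_continuous R 1 n 0 i h)).
suff Lo : f \o shift x = cst (f x) + (L : 'rV[R]_n -> R) +o_ (0 : 'rV[R]_n) id.
  have dE := diff_unique Lc Lo.
  have dfx : differentiable f x by apply/diff_locallyP; rewrite dE.
  by split => // h; rewrite deriveE// dE.
apply/eqaddoP => _/posnumP[e].
pose ee := e%:num / n.+1%:R.
have ee0 : 0 < ee by rewrite divr_gt0.
have : \forall y \near x, forall i, `|'D_(ebasis R i) f y - 'D_(ebasis R i) f x| <= ee.
  apply: (@filter_forall _ _ (fun i y =>
    is_true (`|'D_(ebasis R i) f y - 'D_(ebasis R i) f x| <= ee)) (nbhs x) _) => i.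
  have /cvgrPdist_le/(_ _ ee0) := cf i x.
  by apply: filterS => y; rewrite distrC.
move=> /nbhs_normP[d /= d0 Hd].
have : \forall h \near (0 : 'rV[R]_n), `|h| < d.
  by apply/nbhs_normP; exists d => //= h; rewrite /ball_ /= sub0r normrN.
apply: filterS => h hd.
rewrite !fctE /=.
pose q k : 'rV[R]_n := \row_i (if (i < k)%N then h 0 i else 0).
have q0 : q 0%N = 0 by apply/rowP => i; rewrite !mxE.
have qn : q n = h by apply/rowP => i; rewrite !mxE ltn_ord.
have qS (i : 'I_n) : q i.+1 = q i + h 0 i *: ebasis R i.
  apply/rowP => j; rewrite !mxE /= ltnS leq_eqVlt.
  have [/ord_inj ->|ji] := eqVneq (j : nat) i.
    by rewrite ltnn eqxx add0r mulr1.
  have -> : (j == i) = false by apply/negbTE; apply: contra ji => /eqP ->.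
  by rewrite /= mulr0 addr0.
have tel : f (h + x) - f x = \sum_(i < n) (f (x + q i.+1) - f (x + q i)).
  rewrite -(big_mkord xpredT (fun i => f (x + q i.+1) - f (x + q i))).
  by rewrite telescope_sumr// qn q0 addr0 (addrC x).
rewrite opprD addrA tel /L /= /edot -sumrB.
rewrite (le_trans (ler_norm_sum _ _ _))//.
apply: (@le_trans _ _ (\sum_(i < n) (ee * `|h|))); last first.
  rewrite sumr_const card_ord -mulr_natr /ee.
  rewrite mulrAC ler_wpM2r// -mulrA ler_piMr// mulrC ler_pdivrMr// mul1r.
  by rewrite ler_nat.
apply: ler_sum => i _.
have [t ta Et] := MVT_line (x + q i) (h 0 i) (fun y => df y i).
rewrite qS addrA Et mxE mulrC -mulrBl normrM ler_pM// ?coord_le_norm//.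
apply: Hd; rewrite /ball_ /= -addrA opprD addrA subrr add0r normrN.
apply: le_lt_trans hd; apply: norm_le_coord => // j; rewrite !mxE /=.
have [-> |ji] := eqVneq j i.
  by rewrite ltnn add0r mulr1 (le_trans ta)// coord_le_norm.
by rewrite mulr0 addr0; case: ifP => // _; rewrite ?normr0// coord_le_norm.
Qed.

End Differentiability.

Lemma taylor2_le (R : realType) (f f1 f2 : R -> R) (K : R) :
  (forall t : R, is_derive t (1 : R) f (f1 t)) ->
  (forall t : R, is_derive t (1 : R) f1 (f2 t)) ->
  (forall t, 0 <= t <= 1 -> f2 t <= K) ->
  f 1 <= f 0 + f1 0 + K / 2.
Proof.
move=> df df1 f2K.
have cont (g dg : R -> R) A : (forall t : R, is_derive t (1 : R) g (dg t)) ->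
    {within A, continuous g}.
  move=> dg'; apply: continuous_subspaceT => t.
  by apply: differentiable_continuous; apply/derivable1_diffP; case: (dg' t).
pose g : R -> R := (f - f1 0 \*: id) - (K / 2) \*: (id ^+ 2).
have dg (t : R) : is_derive t (1 : R) g (f1 t - f1 0 - K * t).
  apply: is_derive_eq; rewrite expr1 /GRing.scale /= !mulr1.
  by field.
have [c] := @MVT_segment R g _ 0 1 ler01 (fun t _ => dg t) (cont _ _ _ dg).
rewrite in_itv /= => /andP[c0 c1].
have [e] := @MVT_segment R f1 f2 0 c c0 (fun t _ => df1 t) (cont _ _ _ df1).
rewrite in_itv /= subr0 => /andP[e0 ec] Ee.
rewrite Ee subr0 mulr1 /g !fctE /GRing.scale /= expr0n expr1n /=.
rewrite !scaler0 [(f1 0)%:A]mulr1 [(K / 2)%:A]mulr1 => Eg.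
have /f2K f2e : 0 <= e <= 1 by rewrite e0 (le_trans ec).
have : (f2 e - K) * c <= 0 by rewrite mulr_le0_ge0// subr_le0.
lra.
Qed.

Section C2Theory.
Variables (R : realType) (n : nat).
Implicit Types (f g : 'rV[R]_n -> R) (x h : 'rV[R]_n).

Lemma C2_differentiable f : C2 f ->
  forall x, differentiable f x /\ forall h, 'D_h f x = edot (grad f x) h.
Proof.
move=> [d1 [d2 c2]]; apply: continuous_partial_differentiable => // i x.
apply: differentiable_continuous.
by have [] := continuous_partial_differentiable (fun x => d2 x i) (c2 i) x.
Qed.

Lemma C2_grad_differentiable f i : C2 f ->
  forall x, differentiable ('D_(ebasis R i) f) x /\
    forall h, 'D_h ('D_(ebasis R i) f) x = edot (grad ('D_(ebasis R i) f) x) h.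
Proof.
by move=> [d1 [d2 c2]]; apply: continuous_partial_differentiable.
Qed.

Lemma C2_descent f x h (K : R) : C2 f ->
  (forall t : R, 0 <= t <= 1 -> specnorm (hessian f (x + t *: h)) <= K) ->
  f (x + h) <= f x + edot (grad f x) h + K / 2 * edot h h.
Proof.
move=> Cf HK.
have df (t : R) : is_derive t (1 : R) (fun s : R => f (x + s *: h))
    (edot (grad f (x + t *: h)) h).
  have [d dE] := C2_differentiable Cf (x + t *: h).
  by rewrite -dE; apply: is_derive_line; exact: diff_derivable.
have df1 (t : R) : is_derive t (1 : R) (fun s : R => edot (grad f (x + s *: h)) h)
    (edot (h *m hessian f (x + t *: h)) h).
  have di i : is_derive t (1 : R)
      (h 0 i \*: (fun s : R => 'D_(ebasis R i) f (x + s *: h)))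
      (h 0 i * 'D_h ('D_(ebasis R i) f) (x + t *: h)).
    have [d dE] := C2_grad_differentiable i Cf (x + t *: h).
    by apply: is_deriveZ; apply: is_derive_line; exact: diff_derivable.
  have -> : (fun s : R => edot (grad f (x + s *: h)) h) =
     \sum_(i < n) (h 0 i \*: (fun s : R => 'D_(ebasis R i) f (x + s *: h))).
    apply/funext => s; rewrite fct_sumE; apply: eq_bigr => i _.
    by rewrite mxE mulrC.
  apply: (is_derive_eq (is_derive_sum di)).
  rewrite /edot; under [RHS]eq_bigr do rewrite mxE mulr_suml.
  rewrite exchange_big; apply: eq_bigr => i _ /=.
  have [_ ->] := C2_grad_differentiable i Cf (x + t *: h).
  rewrite mulr_sumr; apply: eq_bigr => j _.
  by rewrite !mxE mulrA.
have := taylor2_le (K := K * edot h h) df df1.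
rewrite scale1r scale0r addr0 mulrAC; apply => t t01.
apply: le_trans (edot_mulmx_le _ _) _.
by rewrite ler_wpM2r ?edot_ge0// HK.
Qed.

Lemma C2D f g : C2 f -> C2 g -> C2 (fun x => f x + g x).
Proof.
move=> [f1 [f2 fc]] [g1 [g2 gc]].
have E i : 'D_(ebasis R i) (fun x => f x + g x) =
    (fun x => 'D_(ebasis R i) f x + 'D_(ebasis R i) g x).
  by apply/funext => x; exact: deriveD.
split; first by move=> x i; exact: derivableD.
split=> [x i j|i j]; rewrite E; first exact: derivableD.
have -> : 'D_(ebasis R j) (fun x => 'D_(ebasis R i) f x + 'D_(ebasis R i) g x) =
   (fun x => 'D_(ebasis R j) ('D_(ebasis R i) f) x +
             'D_(ebasis R j) ('D_(ebasis R i) g) x).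
  by apply/funext => x; exact: deriveD.
by move=> x; exact: (cvgD (fc i j x) (gc i j x)).
Qed.

Lemma C2Z (c : R) f : C2 f -> C2 (fun x => c * f x).
Proof.
move=> [f1 [f2 fc]].
have E i : 'D_(ebasis R i) (fun x => c * f x) = (fun x => c * 'D_(ebasis R i) f x).
  by apply/funext => x; exact: deriveZ.
split; first by move=> x i; exact: derivableZ.
split=> [x i j|i j]; rewrite E; first exact: derivableZ.
have -> : 'D_(ebasis R j) (fun x => c * 'D_(ebasis R i) f x) =
   (fun x => c * 'D_(ebasis R j) ('D_(ebasis R i) f) x).
  by apply/funext => x; exact: deriveZ.
by move=> x; exact: (cvgM (cvg_cst c) (fc i j x)).
Qed.

Lemma is_derive_coord x h i : is_derive x h (fun y : 'rV[R]_n => y 0 i) (h 0 i).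
Proof.
have d := differentiable_coord x 0 i.
apply: DeriveDef; first exact: diff_derivable.
have := derive_mx (@derivable_id R 'rV[R]_n x h).
by rewrite derive_id => /matrixP/(_ 0 i); rewrite mxE => ->.
Qed.

Lemma C2_enorm_sqr : C2 (fun x : 'rV[R]_n => enorm x ^+ 2).
Proof.
have E : (fun x : 'rV[R]_n => enorm x ^+ 2) =
    \sum_(i < n) (fun x : 'rV[R]_n => x 0 i) ^+ 2.
  apply/funext => x; rewrite enorm_sqr fct_sumE.
  by apply: eq_bigr => i _; rewrite fctE expr2.
have d1 x i : is_derive x (ebasis R i) (fun x : 'rV[R]_n => enorm x ^+ 2) (2 * x 0 i).
  rewrite E; apply: is_derive_eq.
    by apply: is_derive_sum => j; apply: is_deriveX; exact: is_derive_coord.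
  rewrite (bigD1 i)//= big1 ?addr0 => [|j /negbTE ji].
    by rewrite mxE !eqxx /= expr1 /GRing.scale /= mulr1.
  by rewrite mxE ji andbF scaler0.
have E1 i : 'D_(ebasis R i) (fun x : 'rV[R]_n => enorm x ^+ 2) =
    2 \*: (fun x : 'rV[R]_n => x 0 i).
  by apply/funext => x; have [_ ->] := d1 x i.
have d2 x i j : is_derive x (ebasis R j) (2 \*: (fun x : 'rV[R]_n => x 0 i))
     (2 * ebasis R j 0 i).
  by apply: is_deriveZ; exact: is_derive_coord.
split; first by move=> x i; have [] := d1 x i.
split=> [x i j|i j]; rewrite E1; first by have [] := d2 x i j.
have -> : 'D_(ebasis R j) (2 \*: (fun x : 'rV[R]_n => x 0 i)) =
    cst (2 * ebasis R j 0 i).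
  by apply/funext => x; have [_ ->] := d2 x i j.
exact: cst_continuous.
Qed.

End C2Theory.

Section Slice.
Variables (R : realType) (p m : nat) (v : 'rV[R]_m).
Implicit Types (f : 'rV[R]_(p + m) -> R) (u : 'rV[R]_p).

Lemma slice_growth f u i :
  (fun h : R => h^-1 *: (((fun u => f (row_mx u v)) \o shift u) (h *: ebasis R i)
     - f (row_mx u v))) =
  (fun h : R => h^-1 *: ((f \o shift (row_mx u v)) (h *: ebasis R (lshift m i))
     - f (row_mx u v))).
Proof.
apply/funext => h /=; congr (_ *: (f _ - _)).
have -> : ebasis R (lshift m i) = row_mx (ebasis R i) 0.
  apply/rowP => j; rewrite !mxE -(inj_eq val_inj j).
  case: splitP => k jk; rewrite !mxE /= jk; first by rewrite -(inj_eq val_inj k).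
  by rewrite gtn_eqF ?andbF// (leq_trans (ltn_ord i))// leq_addr.
by rewrite scale_row_mx scaler0 add_row_mx add0r.
Qed.

Lemma derive_slice f i :
  'D_(ebasis R i) (fun u => f (row_mx u v)) =
  (fun u => 'D_(ebasis R (lshift m i)) f (row_mx u v)).
Proof. by apply/funext => u; rewrite /derive slice_growth. Qed.

Lemma derivable_slice f u i : derivable f (row_mx u v) (ebasis R (lshift m i)) ->
  derivable (fun u => f (row_mx u v)) u (ebasis R i).
Proof. by rewrite /derivable slice_growth. Qed.

Lemma continuous_slice f :
  continuous f -> continuous (fun u => f (row_mx u v)).
Proof.
move=> cf u.
suff cr : row_mx w v @[w --> u] --> row_mx u v.
  exact: (cvg_comp (fun w => row_mx w v) f cr (cf (row_mx u v))).
apply/(cvgrPdist_le (F := nbhs u) (FF := nbhs_filter u)) => e e0.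
apply/(@nbhs_normP R 'rV[R]_p u); exists e => // w /ltW uw; apply: le_trans uw.
rewrite opp_row_mx add_row_mx subrr; apply: norm_le_coord => // j.
rewrite mxE; case: splitP => k _; rewrite ?mxE ?normr0//.
by rewrite -[leLHS]/(`|u 0 k - w 0 k|) (le_trans _ (coord_le_norm _ k))// !mxE.
Qed.

Lemma C2_slice f : C2 f -> C2 (fun u => f (row_mx u v)).
Proof.
move=> [f1 [f2 fc]]; split=> [u i|]; first exact: derivable_slice.
split=> [u i j|i j]; rewrite derive_slice.
  exact: (derivable_slice (f2 _ _ _)).
rewrite (derive_slice ('D_(ebasis R (lshift m i)) f)).
exact: (continuous_slice (fc _ _)).
Qed.

End Slice.

Section EuclideanBall.
Variables (R : realType) (n : nat).
Implicit Types (a x y : 'rV[R]_n) (delta S : \bar R).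

Lemma eball_segment a x y delta (t : R) : 0 <= t <= 1 ->
  eball a delta x -> eball a delta y -> eball a delta (x + t *: (y - x)).
Proof.
rewrite /eball /= !enorm_sqr => t01.
have -> : x + t *: (y - x) - a = (1 - t) *: (x - a) + t *: (y - a).
  by rewrite !scalerBr !scalerBl !scale1r; apply/rowP => i; rewrite !mxE; ring.
have {t01} := (ler_edot_segment (x - a) (y - a) t01, t01).
set p := edot (x - a) _; set q := edot (y - a) _; move=> [le_s /andP[t0 t1]] xd yd.
have [pq|qp] := leP p q.
  apply: le_trans yd; rewrite lee_fin (le_trans le_s)//.
  have : (1 - t) * p <= (1 - t) * q by rewrite ler_wpM2l// subr_ge0.
  lra.
apply: le_trans xd; rewrite lee_fin (le_trans le_s)//.
have : t * q <= t * p by rewrite ler_wpM2l// ltW.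
lra.
Qed.

Lemma eball_affine a x (A B z : R) S : 0 <= B -> (z%:E <= S)%E ->
  edot (x - a) (x - a) <= A + B * z -> eball a (A%:E + B%:E * S)%E x.
Proof.
move=> B0 zS xAB; rewrite /eball /= enorm_sqr.
apply: (@le_trans _ _ (A%:E + B%:E * z%:E)%E); first by rewrite -EFinM -EFinD lee_fin.
by rewrite leeD2l// lee_wpmul2l// lee_fin.
Qed.

End EuclideanBall.

Section ProximalStep.
Variables (R : realType) (n : nat).
Implicit Types (a x : 'rV[R]_n) (f : 'rV[R]_n -> R).

Lemma C2_descent_segment f x y (K : R) : C2 f ->
  (forall t : R, 0 <= t <= 1 -> specnorm (hessian f (x + t *: (y - x))) / 2 <= K) ->
  f y <= f x + edot (grad f x) (y - x) + K * edot (y - x) (y - x).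
Proof.
move=> Cf HK; have := C2_descent (x := x) (h := y - x) (K := 2 * K) Cf.
rewrite subrKC (mulrC 2) mulfK//; apply => t /HK; lra.
Qed.

Lemma prox_center_identity a x y xi (c k : R) : 0 < k + c ->
  y = (k + c)^-1 *: (k *: x + c *: a - 2^-1 *: xi) ->
  c * edot (x - a) (x - a) = c * edot (y - a) (y - a) + edot xi (y - x)
     + (2 * k + c) * edot (y - x) (y - x).
Proof.
move=> kc yE.
have -> : xi = - (2 * k) *: (y - x) - (2 * c) *: (y - a).
  have : (k + c) *: y = k *: x + c *: a - 2^-1 *: xi.
    by rewrite yE scalerA divff ?scale1r// gt_eqF.
  move=> E; apply/rowP => i; move/rowP/(_ i): E; rewrite !mxE; lra.
have -> : x - a = (y - a) - (y - x) by apply/rowP => i; rewrite !mxE; ring.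
move: (y - a) (y - x) => s d.
rewrite !(edotDl, edotDr, edotNl, edotNr, edotZl, edotZr) (edotC s d); ring.
Qed.

Lemma prox_center_dist a x y xi (c k : R) : 0 < c -> 0 < k ->
  y = (k + c)^-1 *: (k *: x + c *: a - 2^-1 *: xi) ->
  edot (y - a) (y - a) <= edot (x - a) (x - a) + (2 / c ^+ 2) * edot xi xi.
Proof.
move=> c0 k0 ->; have kc : 0 < k + c by rewrite addr_gt0.
pose t := c / (k + c).
have t01 : 0 <= t <= 1.
  by rewrite divr_ge0 ?(ltW c0) ?(ltW kc)//= ler_pdivrMr// mul1r lerDr ltW.
have -> : (k + c)^-1 *: (k *: x + c *: a - 2^-1 *: xi) - a =
    (1 - t) *: (x - a) + t *: (- (2 * c)^-1 *: xi).
  apply/rowP => i; rewrite !mxE /t; field.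
  by rewrite !gt_eqF.
apply: le_trans (ler_edot_segment _ _ t01) _.
have -> : edot (- (2 * c)^-1 *: xi) (- (2 * c)^-1 *: xi) =
    1 / 4 * ((c ^+ 2)^-1 * edot xi xi).
  by rewrite edotZl edotZr; field; rewrite gt_eqF.
have [t0 t1] := andP t01.
have X0 := edot_ge0 (x - a).
have Z0 : 0 <= (c ^+ 2)^-1 * edot xi xi.
  by rewrite mulr_ge0 ?edot_ge0// invr_ge0 sqr_ge0.
have tX : 0 <= t * edot (x - a) (x - a) by rewrite mulr_ge0.
have tZ : 0 <= (1 - t) * ((c ^+ 2)^-1 * edot xi xi) by rewrite mulr_ge0// subr_ge0.
lra.
Qed.

Section Quadratic.
Variables (d : nat) (phi : 'I_d -> 'rV[R]_n) (c1 c4 : R).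

Definition quadratic_part y : R :=
  c1 * \sum_t edot (phi t - y) (phi t - y) + c4 * edot y y.

Lemma prox_quadratic_identity x y xi (k : R) : 0 < c1 * d%:R + c4 + k ->
  y = (c1 * d%:R + c4 + k)^-1 *: (c1 *: \sum_t phi t + k *: x - 2^-1 *: xi) ->
  quadratic_part x = quadratic_part y + edot xi (y - x)
     + (2 * k + c1 * d%:R + c4) * edot (y - x) (y - x).
Proof.
move=> kc yE.
have -> : xi = - (2 * k) *: (y - x) + (2 * c1) *: \sum_t phi t
    - (2 * (c1 * d%:R + c4)) *: y.
  have : (c1 * d%:R + c4 + k) *: y = c1 *: \sum_t phi t + k *: x - 2^-1 *: xi.
    by rewrite yE scalerA divff ?scale1r// gt_eqF.
  move: (\sum_t phi t) => s E; apply/rowP => i; move/rowP/(_ i): E; rewrite !mxE; lra.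
have Ex : x = y - (y - x) by rewrite subKr.
rewrite {1}Ex /quadratic_part; move: (y - x) {Ex kc yE} => e.
have -> : \sum_t edot (phi t - (y - e)) (phi t - (y - e)) =
   \sum_t edot (phi t - y) (phi t - y) + 2 * edot (\sum_t phi t) e
   - 2 * d%:R * edot y e + d%:R * edot e e.
  rewrite edot_suml mulr_sumr.
  have -> (z : R) : 2 * d%:R * z = \sum_(t < d) (2 * z).
    by rewrite sumr_const card_ord -mulr_natl; ring.
  have -> (z : R) : d%:R * z = \sum_(t < d) z by rewrite sumr_const card_ord mulr_natl.
  rewrite -!big_split -sumrB -big_split; apply: eq_bigr => t _ /=.
  rewrite !(edotDl, edotDr, edotNl, edotNr) (edotC y (phi t)).
  by rewrite (edotC e (phi t)) (edotC e y); ring.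
rewrite !(edotDl, edotDr, edotNl, edotNr, edotZl, edotZr) (edotC e y); ring.
Qed.

Lemma prox_quadratic_norm x y xi (k F0 : R) : 0 <= c1 -> 0 < c4 -> 0 < k ->
  y = (c1 * d%:R + c4 + k)^-1 *: (c1 *: \sum_t phi t + k *: x - 2^-1 *: xi) ->
  quadratic_part x <= F0 -> edot y y <= 3 / c4 * F0 + 2 / c4 ^+ 2 * edot xi xi.
Proof.
move=> c10 c40 k0 yE xF.
have cd : 0 <= c1 * d%:R by rewrite mulr_ge0.
have S0 z : 0 <= c1 * \sum_t edot (phi t - z) (phi t - z).
  by rewrite mulr_ge0// sumr_ge0// => t _; exact: edot_ge0.
have kc : 0 < c1 * d%:R + c4 + k by rewrite addr_gt0// ltr_wpDl.
have E := prox_quadratic_identity kc yE.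
have E0 : 0 <= (2 * k + c1 * d%:R + c4) * edot (y - x) (y - x).
  by rewrite mulr_ge0 ?edot_ge0//; lra.
have Y1 : - edot xi y <= (c4 * edot y y + c4^-1 * edot xi xi) / 2.
  by have := edot_young y (- xi) c40; rewrite !(edotNl, edotNr) opprK (edotC y).
have Y2 : edot xi x <= (c4 * edot x x + c4^-1 * edot xi xi) / 2.
  by rewrite edotC; exact: edot_young.
have := S0 y; have := S0 x => Sx Sy.
rewrite edotDr edotNr in E.
rewrite -(ler_pM2l c40).
have -> : c4 * (3 / c4 * F0 + 2 / c4 ^+ 2 * edot xi xi) =
    3 * F0 + 2 * (c4^-1 * edot xi xi).
  by field; rewrite gt_eqF.
rewrite /quadratic_part in E xF; lra.
Qed.

End Quadratic.
End ProximalStep.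

Section SufficientDecrease.
Variables (R : realType) (w : nat -> R) (n : nat) (x : nat -> 'rV[R]_n) (c : R).
Hypotheses (c_gt0 : 0 < c) (w_cvg : cvg (w @ \oo)).
Hypothesis decrease : forall l, c * edot (x l) (x l) <= w l - w l.+1.

Lemma sufficient_decrease_cvg0 : x @ \oo --> (0 : 'rV[R]_n).
Proof.
have dw : (fun l => w l - w l.+1) @ \oo --> (0 : R).
  rewrite -(subrr (lim (w @ \oo))); apply: cvgB => //.
  by have := w_cvg; rewrite -(cvg_shiftS w).
apply/cvgr0Pnorm_le => e e0.
have ce : 0 < c * e ^+ 2 by rewrite mulr_gt0// exprn_gt0.
have /cvgr0Pnorm_le/(_ _ ce) := dw.
apply: filterS => l le_w.
apply: norm_le_coord => [|i]; first exact: ltW.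
rewrite -(@ler_pXn2r _ 2)// ?nnegrE ?(ltW e0)// real_normK ?num_real//.
apply: le_trans (sqr_coord_le_edot _ _) _.
by rewrite -(ler_pM2l c_gt0) (le_trans (decrease l))// (le_trans (ler_norm _)).
Qed.

End SufficientDecrease.

Theorem mainTheorem1 (R : realType) (p m : nat) (W X Y O : Type)
  (varphi : 'rV[R]_p -> X -> 'rV[R]_m)
  (phi : W -> 'rV[R]_m -> X -> O) (loss : O -> Y -> R)
  (loss_ge0 : forall o y, 0 <= loss o y)
  (d : nat) (d_ge1 : (0 < d)%N) (xs : 'I_d -> X) (ys : 'I_d -> Y)
  (wstar : W) (ustar : 'rV[R]_p)
  (c1 c2 c3 c4 : R) (c1_gt0 : 0 < c1) (c2_gt0 : 0 < c2)
  (c3_gt0 : 0 < c3) (c4_gt0 : 0 < c4)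
  (C2_fvarphi : C2 (fun z : 'rV[R]_(p + m) =>
                      fvarphi varphi xs (lsubmx z) (rsubmx z)))
  (C2_fphi : C2 (fphi phi loss xs ys wstar))
  (tau kappa : nat -> R) (tau_gt0 : forall l, 0 < tau l)
  (kappa_gt0 : forall l, 0 < kappa l)
  (u : nat -> 'rV[R]_p) (v : nat -> 'rV[R]_m) :
  let g := fun (u' : 'rV[R]_p) (v' : 'rV[R]_m) =>
             c1 * fvarphi varphi xs u' v' + c3 * enorm u' ^+ 2 in
  let F := fun (u' : 'rV[R]_p) (v' : 'rV[R]_m) =>
             g u' v' + fphi phi loss xs ys wstar v'
             + c2 * enorm (u' - ustar) ^+ 2 + c4 * enorm v' ^+ 2 in
  u 0%N = ustar ->
  v 0%N = (d%:R)^-1 *: \sum_(t < d) varphi ustar (xs t) ->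
  (forall l, u l.+1 = (tau l + c2)^-1 *:
       (tau l *: u l + c2 *: ustar - 2^-1 *: grad (fun u' => g u' (v l)) (u l))) ->
  (forall l, v l.+1 = (c1 * d%:R + c4 + kappa l)^-1 *:
       (c1 *: \sum_(t < d) varphi (u l.+1) (xs t) + kappa l *: v l
        - 2^-1 *: grad (fphi phi loss xs ys wstar) (v l))) ->
  let F0 := F (u 0%N) (v 0%N) in
  let Omega := [set z : 'rV[R]_p * 'rV[R]_m | F z.1 z.2 <= F0] in
  let delta_u := ((3 / c2 * F0)%:E + (2 / c2 ^+ 2)%:E *
        ereal_sup [set (enorm (grad (fun u' => g u' z.2) z.1) ^+ 2)%:E
                  | z in Omega])%E in
  let delta_v := ((3 / c4 * F0)%:E + (2 / c4 ^+ 2)%:E *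
        ereal_sup [set (enorm (grad (fphi phi loss xs ys wstar) z.2) ^+ 2)%:E
                  | z in Omega])%E in
  let tau_star := ereal_sup
        [set (specnorm (hessian (fun u' => g u' z.2) z.1) / 2)%:E
        | z in eball ustar delta_u `*` eball 0 (F0 / c4)%:E] in
  let kappa_star := ereal_sup
        [set (specnorm (hessian (fphi phi loss xs ys wstar) v') / 2)%:E
        | v' in eball 0 delta_v] in
  (forall l, (tau_star < (tau l)%:E)%E) ->
  (forall l, (kappa_star < (kappa l)%:E)%E) ->
  (forall l, F (u l.+1) (v l.+1) <= F (u l) (v l)) /\
  (forall l, (u l.+1, v l.+1) <> (u l, v l) ->
             F (u l.+1) (v l.+1) < F (u l) (v l)) /\
  cvg ((fun l => F (u l) (v l)) @ \oo) /\
  ((fun l => u l.+1 - u l) @ \oo --> (0 : 'rV[R]_p)) /\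
  ((fun l => v l.+1 - v l) @ \oo --> (0 : 'rV[R]_m)).
Proof.
move=> g F _ _ uS vS F0 Omega delta_u delta_v tau_star kappa_star tauP kappaP.
pose H := fphi phi loss xs ys wstar.
have H0 y : 0 <= H y by apply: sumr_ge0.
have fv0 x y : 0 <= fvarphi varphi xs x y.
  by apply: sumr_ge0 => t _; exact: sqr_ge0.
have Cg y : C2 (fun x => g x y).
  apply: C2D; last by apply: C2Z; exact: C2_enorm_sqr.
  apply: C2Z; have := C2_slice y C2_fvarphi.
  by congr C2; apply/funext => x; rewrite row_mxKl row_mxKr.
have g0 x y : 0 <= g x y.
  by rewrite addr_ge0// mulr_ge0 ?sqr_ge0// ltW.
have FE x y : F x y = g x y + H y + c2 * edot (x - ustar) (x - ustar) + c4 * edot y y.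
  by rewrite /F !enorm_sqr.
have qx x : 0 <= c2 * edot (x - ustar) (x - ustar) by rewrite mulr_ge0 ?edot_ge0// ltW.
have qy (y : 'rV[R]_m) : 0 <= c4 * edot y y by rewrite mulr_ge0 ?edot_ge0// ltW.
have F_ge0 x y : 0 <= F x y.
  by rewrite FE; have := (g0 x y, H0 y, qx x, qy y) => -[[[? ?] ?] ?]; lra.
have F_gex x y : c2 * edot (x - ustar) (x - ustar) <= F x y.
  by rewrite FE; have := (g0 x y, H0 y, qx x, qy y) => -[[[? ?] ?] ?]; lra.
have F_gey x y : c4 * edot y y <= F x y.
  by rewrite FE; have := (g0 x y, H0 y, qx x, qy y) => -[[[? ?] ?] ?]; lra.
have FQ x y : F x y = H y + quadratic_part (fun t => varphi x (xs t)) c1 c4 y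
    + (c3 * edot x x + c2 * edot (x - ustar) (x - ustar)).
  rewrite FE /g /quadratic_part /fvarphi enorm_sqr.
  under eq_bigr do rewrite enorm_sqr.
  by ring.
have ustep l : F (u l) (v l) <= F0 ->
    F (u l.+1) (v l) <= F (u l) (v l)
      - (tau l + c2) * edot (u l.+1 - u l) (u l.+1 - u l).
  move=> lF0; pose zeta := grad (fun u' => g u' (v l)) (u l).
  have zS : ((edot zeta zeta)%:E <= ereal_sup
      [set (enorm (grad (fun u' => g u' z.2) z.1) ^+ 2)%:E | z in Omega])%E.
    by apply: ereal_sup_ubound; exists (u l, v l) => //=; rewrite enorm_sqr.
  have F00 : 0 <= F0 by exact: F_ge0.
  have u0 : edot (u l - ustar) (u l - ustar) <= F0 / c2.
    by rewrite ler_pdivlMr// mulrC; exact: le_trans lF0.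
  have c2z : 0 <= 2 / c2 ^+ 2 * edot zeta zeta.
    by rewrite mulr_ge0 ?edot_ge0// divr_ge0// sqr_ge0.
  have F0c : 0 <= F0 / c2 by rewrite divr_ge0// ltW.
  have b0 : eball ustar delta_u (u l).
    apply: (eball_affine _ zS); first by rewrite divr_ge0// sqr_ge0.
    lra.
  have b1 : eball ustar delta_u (u l.+1).
    apply: (eball_affine _ zS); first by rewrite divr_ge0// sqr_ge0.
    have := prox_center_dist c2_gt0 (tau_gt0 l) (uS l); rewrite -/zeta; lra.
  have bv : eball 0 (F0 / c4)%:E (v l).
    rewrite /eball /= subr0 enorm_sqr lee_fin ler_pdivlMr// mulrC.
    exact: le_trans lF0.
  have := C2_descent_segment (x := u l) (y := u l.+1) (K := tau l) (Cg (v l)).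
  have tc : 0 < tau l + c2 by rewrite addr_gt0.
  have := prox_center_identity tc (uS l); rewrite -/zeta !FE => E D.
  suff /D : forall t : R, 0 <= t <= 1 ->
    specnorm (hessian (fun x => g x (v l)) (u l + t *: (u l.+1 - u l))) / 2 <= tau l.
    by lra.
  move=> t t01; rewrite -lee_fin; apply: le_trans (ltW (tauP l)).
  apply: ereal_sup_ubound; exists (u l + t *: (u l.+1 - u l), v l) => //=.
  by split=> //=; exact: eball_segment.
have vstep l : F (u l) (v l) <= F0 -> F (u l.+1) (v l) <= F0 ->
    F (u l.+1) (v l.+1) <= F (u l.+1) (v l)
      - (kappa l + c1 * d%:R + c4) * edot (v l.+1 - v l) (v l.+1 - v l).
  move=> lF0 lF0'; pose xi := grad H (v l).
  have zS : ((edot xi xi)%:E <= ereal_sup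
      [set (enorm (grad H z.2) ^+ 2)%:E | z in Omega])%E.
    by apply: ereal_sup_ubound; exists (u l, v l) => //=; rewrite enorm_sqr.
  have F00 : 0 <= F0 by exact: F_ge0.
  have v0 : edot (v l) (v l) <= F0 / c4.
    by rewrite ler_pdivlMr// mulrC; exact: le_trans lF0.
  have c4z : 0 <= 2 / c4 ^+ 2 * edot xi xi.
    by rewrite mulr_ge0 ?edot_ge0// divr_ge0// sqr_ge0.
  have F0c : 0 <= F0 / c4 by rewrite divr_ge0// ltW.
  have cd : 0 <= c1 * d%:R by rewrite mulr_ge0// ltW.
  have kc : 0 < c1 * d%:R + c4 + kappa l by rewrite addr_gt0// ltr_wpDl.
  have b0 : eball 0 delta_v (v l).
    apply: (eball_affine _ zS); first by rewrite divr_ge0// sqr_ge0.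
    rewrite subr0; lra.
  have b1 : eball 0 delta_v (v l.+1).
    apply: (eball_affine _ zS); first by rewrite divr_ge0// sqr_ge0.
    rewrite subr0.
    apply: (prox_quadratic_norm (ltW c1_gt0) c4_gt0 (kappa_gt0 l) (vS l)).
    apply: le_trans lF0'; rewrite FQ.
    have c3u : 0 <= c3 * edot (u l.+1) (u l.+1) by rewrite mulr_ge0 ?edot_ge0// ltW.
    by have := (H0 (v l), qx (u l.+1)) => -[? ?]; lra.
  have := C2_descent_segment (x := v l) (y := v l.+1) (K := kappa l) C2_fphi.
  have := prox_quadratic_identity kc (vS l); rewrite -/H -/xi !FQ => E D.
  suff /D : forall t : R, 0 <= t <= 1 ->
    specnorm (hessian H (v l + t *: (v l.+1 - v l))) / 2 <= kappa l by lra.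
  move=> t t01; rewrite -lee_fin; apply: le_trans (ltW (kappaP l)).
  apply: ereal_sup_ubound; exists (v l + t *: (v l.+1 - v l)) => //=.
  exact: eball_segment.
have cd : 0 <= c1 * d%:R by rewrite mulr_ge0// ltW.
have step l : F (u l) (v l) <= F0 ->
    F (u l.+1) (v l.+1) <= F (u l) (v l)
      - (c2 * edot (u l.+1 - u l) (u l.+1 - u l)
         + c4 * edot (v l.+1 - v l) (v l.+1 - v l)).
  move=> lF0; have U := ustep l lF0.
  have U0 := edot_ge0 (u l.+1 - u l); have V0 := edot_ge0 (v l.+1 - v l).
  have tU : 0 <= tau l * edot (u l.+1 - u l) (u l.+1 - u l).
    by rewrite mulr_ge0// ltW.
  have cU : 0 <= c2 * edot (u l.+1 - u l) (u l.+1 - u l).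
    by rewrite mulr_ge0// ltW.
  have kV : 0 <= (kappa l + c1 * d%:R) * edot (v l.+1 - v l) (v l.+1 - v l).
    by rewrite mulr_ge0// addr_ge0// ltW.
  have V : F (u l.+1) (v l) <= F0 by lra.
  have := vstep l lF0 V; lra.
have dU l : 0 <= c2 * edot (u l.+1 - u l) (u l.+1 - u l).
  by rewrite mulr_ge0 ?edot_ge0// ltW.
have dV l : 0 <= c4 * edot (v l.+1 - v l) (v l.+1 - v l).
  by rewrite mulr_ge0 ?edot_ge0// ltW.
have FF0 l : F (u l) (v l) <= F0.
  elim: l => [//|l IH]; have := step l IH; have := dU l; have := dV l; lra.
have {}step l := step l (FF0 l).
have mono l : F (u l.+1) (v l.+1) <= F (u l) (v l).
  have := step l; have := dU l; have := dV l; lra.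
have Fcvg : cvg ((fun l => F (u l) (v l)) @ \oo).
  apply: nonincreasing_is_cvgn; first exact/nonincreasing_seqP.
  by exists 0 => _ [l _ <-].
split=> //; split.
  move=> l neq; rewrite lt_neqAle mono andbT; apply/eqP => eqF; apply: neq.
  have E := step l; have dUl := dU l; have dVl := dV l.
  have /eqP : c2 * edot (u l.+1 - u l) (u l.+1 - u l) = 0 by lra.
  have /eqP : c4 * edot (v l.+1 - v l) (v l.+1 - v l) = 0 by lra.
  rewrite !mulf_eq0 (gt_eqF c2_gt0) (gt_eqF c4_gt0) /= => /eqP/edot_eq0/subr0_eq ->.
  by move=> /eqP/edot_eq0/subr0_eq ->.
split=> //; split.
  apply: (sufficient_decrease_cvg0 c2_gt0 Fcvg) => l.
  have := step l; have := dV l; lra.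
apply: (sufficient_decrease_cvg0 c4_gt0 Fcvg) => l.
have := step l; have := dU l; lra.
Qed.
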